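(* For every integer $n\geq 3$, the $n$-barbell graph $B_n$ is antimagic.
   Context: All graphs are simple, finite and undirected. For a graph $G$ with $q$ edges, an antimagic labeling is a bijection $f:E(G)\to\{1,2,\dots,q\}$ such that the vertex sums $w(u)=\sum_{e\ni u} f(e)$ (sum over the edges incident to $u$) are pairwise distinct over all vertices $u\in V(G)$. A graph is antimagic if it admits an antimagic labeling. The $n$-barbell graph $B_n$ ($n\geq 3$) is obtained from two vertex-disjoint copies of the complete graph $K_n$ by adding one edge joining a vertex of the first copy to a vertex of the second copy. *)

(* Defs.v *)
From mathcomp Require Import all_boot.

Set Implicit Arguments.
Unset Strict Implicit.
Unset Printing Implicit Defensive.

Record sgraph := SGraph {
  vertex :> finType;
  adj : rel vertex;
  adj_sym : symmetric adj;
  adj_irr : irreflexive adj }.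

(* An edge is the unordered pair [set x; y] of its two (distinct) ends. *)
Definition edges (G : sgraph) : {set {set G}} :=
  [set e : {set G} | [exists x, exists y, adj x y && (e == [set x; y])]].

Definition vertex_sum (G : sgraph) (f : {set G} -> nat) (u : G) : nat :=
  \sum_(e in edges G | u \in e) f e.

(* The labeling is a function on all sets of vertices, of which only the
   values on edges matter: it maps [edges G] bijectively onto {1, ..., q}. *)
Definition edge_labeling (G : sgraph) (f : {set G} -> nat) : Prop :=
  [/\ forall e, e \in edges G -> 1 <= f e <= #|edges G|,
      {in edges G &, injective f}
    & forall k, 1 <= k <= #|edges G| -> exists2 e, e \in edges G & f e = k].

Definition antimagic_labeling (G : sgraph) (f : {set G} -> nat) : Prop :=
  edge_labeling f /\ injective (vertex_sum f).

Definition antimagic (G : sgraph) : Prop :=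
  exists f : {set G} -> nat, antimagic_labeling f.

(* Two disjoint copies of K_n, with vertices [inl i] and [inr i], and the
   bridge between [inl a] and [inr b]. *)
Definition barbell_adj (n : nat) (a b : 'I_n) : rel ('I_n + 'I_n) :=
  fun u v => match u, v with
  | inl i, inl j => i != j
  | inr i, inr j => i != j
  | inl i, inr j => (i == a) && (j == b)
  | inr j, inl i => (i == a) && (j == b)
  end.

Lemma barbell_sym (n : nat) (a b : 'I_n) : symmetric (barbell_adj a b).
Proof. by move=> [i|i] [j|j] //=; rewrite eq_sym. Qed.

Lemma barbell_irr (n : nat) (a b : 'I_n) : irreflexive (barbell_adj a b).
Proof. by move=> [i|i] /=; rewrite eqxx. Qed.

Definition barbell (n : nat) (a b : 'I_n) : sgraph :=
  SGraph (barbell_sym a b) (barbell_irr a b).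

(* Main.v *)
Require Import Defs.
From mathcomp Require Import all_boot perm.
From mathcomp Require Import zify.

(** Put the labels [1..m], [m = 'C(n, 2)], on the first clique, [m + 1] on the
    bridge and [m + 2 .. 2 m + 1] on the second clique, each clique being
    labeled in colexicographic order.  Colexicographic vertex sums increase
    strictly with the vertex (a third vertex makes the increase strict, whence
    [n >= 3]), and if the cliques are numbered so that the ends of the bridge
    come last, adding the bridge preserves this order.  Finally every sum lies
    in [m, m (n - 1) + m + 1], and the second clique is shifted by
    [(m + 1) (n - 1)], so no sum of the first clique reaches one of the
    second. *)

Set Implicit Arguments.
Unset Strict Implicit.
Unset Printing Implicit Defensive.

(** * Edges as unordered pairs, and labelings given on pairs of vertices *)

Lemma eq_set2 (T : finType) (x y u v : T) :
  [set x; y] = [set u; v] -> (x = u /\ y = v) \/ (x = v /\ y = u).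
Proof.
move=> E.
have := set21 x y; rewrite E !inE => /orP[]/eqP xE; have := set22 x y;
  rewrite E !inE => /orP[]/eqP yE; subst; auto.
- by have := set22 u v; rewrite -E !inE => /orP[]/eqP ->; left.
- by have := set21 u v; rewrite -E !inE => /orP[]/eqP ->; left.
Qed.

Lemma edgesP (G : sgraph) (e : {set G}) :
  reflect (exists x y, adj x y /\ e = [set x; y]) (e \in edges G).
Proof.
rewrite inE; apply: (iffP existsP) => [[x /existsP[y /andP[xy /eqP->]]]|].
  by exists x, y.
by move=> [x [y [xy ->]]]; exists x; apply/existsP; exists y; rewrite xy /=.
Qed.

Lemma vertex_sumE (G : sgraph) (f : {set G} -> nat) (u : G) :
  vertex_sum f u = \sum_(v | adj u v) f [set u; v].
Proof.
rewrite -(big_imset (h := fun v => [set u; v]) f (A := [pred v | adj u v])) /=; last first.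
  move=> v w _ _ /eq_set2[[]//|[uw vu]]; congruence.
apply: eq_bigl => e; apply/andP/imsetP => [[/edgesP[x [y [xy ->]]]]|[v uv ->]].
  rewrite !inE => /orP[]/eqP->; first by exists y.
  by exists x; rewrite ?inE 1?adj_sym // setUC.
by split; [apply/edgesP; exists u, v | rewrite set21].
Qed.

(** This spares a direct count of the edges: their labels list [iota 1 q] up to order, which forces
    [q] to be their number. *)
Lemma edge_labelingI (G : sgraph) (f : {set G} -> nat) (q : nat) :
  (forall e, e \in edges G -> 1 <= f e <= q) ->
  {in edges G &, injective f} ->
  (forall k, 1 <= k <= q -> exists2 e, e \in edges G & f e = k) ->
  edge_labeling f.
Proof.
move=> fq finj fsurj; suff E : #|edges G| = q by split; rewrite ?E.
have /perm_size : perm_eq [seq f e | e <- enum (edges G)] (iota 1 q).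
  apply: uniq_perm; rewrite ?iota_uniq //.
    by rewrite map_inj_in_uniq ?enum_uniq // => e e'; rewrite !mem_enum; apply: finj.
  move=> k; rewrite mem_iota add1n ltnS; apply/mapP/idP => [[e]|/fsurj[e eG <-]].
    by rewrite mem_enum => /fq ? ->.
  by exists e; rewrite ?mem_enum.
by rewrite size_map size_iota -cardE.
Qed.

(** [pick] chooses one of the orders of the two ends, which is harmless for symmetric [F]; the
    default 0 is never met on an edge. *)
Definition set2_fun (T : finType) (F : T -> T -> nat) (e : {set T}) : nat :=
  if [pick p : T * T | e == [set p.1; p.2]] is Some p then F p.1 p.2 else 0.

Lemma set2_funE (T : finType) (F : T -> T -> nat) (x y : T) :
  (forall u v, F u v = F v u) -> set2_fun F [set x; y] = F x y.
Proof.
move=> Fsym; rewrite /set2_fun; case: pickP => [[u v] /eqP|/(_ (x, y))]; last first.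
  by rewrite eqxx.
by move=> /= /eq_set2[][-> ->].
Qed.

(** * Colexicographic ranks, counted from 1, of pairs of distinct numbers *)

Definition colex (i j : nat) : nat := 'C(maxn i j, 2) + (minn i j).+1.

Lemma colexC (i j : nat) : colex i j = colex j i.
Proof. by rewrite /colex maxnC minnC. Qed.

Lemma colex_gt0 (i j : nat) : 0 < colex i j.
Proof. by rewrite /colex addnS. Qed.

(** The ['C(j, 2)] pairs below [j] come first, then the pairs of [j] with [0], ..., [i]. *)
Lemma colex_lt (i j : nat) : i < j -> colex i j = 'C(j, 2) + i.+1.
Proof. by move=> ij; rewrite /colex (maxn_idPr _) ?(minn_idPl _) 1?ltnW. Qed.

Lemma colex_le_bin (n i j : nat) : i < j -> j < n -> colex i j <= 'C(n, 2).
Proof.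
move=> ij jn; rewrite colex_lt //.
by have := leq_bin2l 2 jn; rewrite binS bin1; lia.
Qed.

Lemma colex_le (n i j : nat) : i != j -> i < n -> j < n -> colex i j <= 'C(n, 2).
Proof.
case: (ltngtP i j) => // ij _ hi hj; first exact: colex_le_bin.
by rewrite colexC; apply: colex_le_bin.
Qed.

Lemma leq_colex (i j : nat) : i != j -> j <= colex i j.
Proof.
have le_bin k : k <= ('C(k, 2)).+1 by elim: k => // k; rewrite binS bin1; lia.
case: (ltngtP i j) => // ij _; last by rewrite colexC colex_lt //; lia.
by rewrite colex_lt //; have := le_bin j; lia.
Qed.

(** Pairs with larger element [j] have their ranks in the block from ['C(j, 2) + 1] to
    ['C(j.+1, 2)], and blocks for different [j] are disjoint. *)
Lemma colex_lt_inj (i j k l : nat) :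
  i < j -> k < l -> colex i j = colex k l -> i = k /\ j = l.
Proof.
move=> ij kl; rewrite !colex_lt //.
case: (ltngtP j l) => [jl|lj|->]; last lia.
- by have := leq_bin2l 2 jl; rewrite binS bin1; lia.
- by have := leq_bin2l 2 lj; rewrite binS bin1; lia.
Qed.

Lemma colex_inj (i j k l : nat) : i != j -> k != l ->
  colex i j = colex k l -> (i = k /\ j = l) \/ (i = l /\ j = k).
Proof.
case: (ltngtP i j) => // ij _; case: (ltngtP k l) => // kl _.
- by move=> /(colex_lt_inj ij kl); left.
- by rewrite (colexC k) => /(colex_lt_inj ij kl); right.
- by rewrite (colexC i) => /(colex_lt_inj ij kl)[-> ->]; right.
- by rewrite (colexC i) (colexC k) => /(colex_lt_inj ij kl)[-> ->]; left.
Qed.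

Lemma colex_surj (n k : nat) : 1 <= k <= 'C(n, 2) ->
  exists i j, [/\ i < j, j < n & colex i j = k].
Proof.
elim: n => [|n IHn]; first by rewrite bin0n; lia.
rewrite binS bin1 => kle; have [le_k|lt_k] := leqP k 'C(n, 2).
  by have [|i [j [? ? ?]]] := IHn; [lia | exists i, j; split; lia].
(* Here [k] lies in the block of pairs with larger element [n]; the predecessor appears because
   ranks start at 1. *)
by exists (k - 'C(n, 2)).-1, n; split; rewrite ?colex_lt; lia.
Qed.

Lemma colex_ltr (k i j : nat) : k != i -> k != j -> i < j -> colex k i < colex k j.
Proof.
move=> ki kj ij; have le_ij := leq_bin2l 2 (ltnW ij).
case: (ltngtP k i) ki => // ki _; case: (ltngtP k j) kj => // kj _; try lia.
(* Strictness comes from ['C(i, 2) + i <= 'C(j, 2)], where [i] is positive since [k < i]. *)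
- rewrite !colex_lt //; have := leq_bin2l 2 ij; rewrite binS bin1; lia.
- by rewrite (colexC k) !colex_lt //; have := leq_bin2l 2 (ltnW kj); lia.
- by rewrite !(colexC k) !colex_lt //; lia.
Qed.

(** * Vertex sums of one colexicographically labeled clique *)

Definition colex_sum (n : nat) (i : 'I_n) : nat := \sum_(j < n | i != j) colex i j.

Lemma colex_sum_lt (n : nat) (i j : 'I_n) : 3 <= n -> i < j -> colex_sum i < colex_sum j.
Proof.
move=> n3 ij; have neij : i != j by rewrite neq_ltn ij.
(* The edge between [i] and [j] counts in both sums and cancels; the rest is compared at each of the
   [n - 2] third vertices, with a gain of at least 1. *)
rewrite /colex_sum (bigD1 j) //= [X in _ < X](bigD1 i) 1?eq_sym //= colexC ltn_add2l.
rewrite [X in _ < X](eq_bigl (fun k => (i != k) && (k != j))); last first.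
  by move=> k; rewrite andbC (eq_sym k i) (eq_sym j k).
have card_gt0 : 0 < \sum_(k < n | (i != k) && (k != j)) 1.
  rewrite (eq_bigl (mem (~: [set i; j]))) => [|k]; last first.
    by rewrite !inE negb_or (eq_sym k i).
  by rewrite sum1_card cardsCs setCK cards2 neij card_ord subn_gt0.
have : \sum_(k < n | (i != k) && (k != j)) (colex i k + 1)
       <= \sum_(k < n | (i != k) && (k != j)) colex j k.
  apply: leq_sum => k /andP[ik kj]; rewrite addn1 !(colexC _ k).
  by apply: colex_ltr => //; rewrite eq_sym.
by rewrite big_split; apply: leq_trans; rewrite -addn1 leq_add2l.
Qed.

Lemma colex_sum_le (n : nat) (i : 'I_n) : colex_sum i <= 'C(n, 2) * n.-1.
Proof.
have -> : 'C(n, 2) * n.-1 = \sum_(j < n | i != j) 'C(n, 2).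
  rewrite sum_nat_const mulnC; congr (_ * _).
  by rewrite -[n in n.-1]card_ord -(cardC1 i); apply: eq_card => j; rewrite !inE eq_sym.
by apply: leq_sum => j ij; apply: colex_le.
Qed.

(** As ['C(n, 2)] is the sum of all [j < n], each neighbour [j] pays for its own term; the term [i],
    absent from the right, is paid by the neighbour 0. *)
Lemma leq_colex_sum (n : nat) (i : 'I_n) : 'C(n, 2) <= colex_sum i.
Proof.
rewrite -bin2_sum big_mkord /colex_sum.
case: n i => [[]//|n] i.
have [->|i0] := eqVneq i ord0.
  rewrite (bigD1 ord0) //= add0n (eq_bigl (fun j => ord0 != j)) => [|j]; last by rewrite eq_sym.
  by apply: leq_sum => j; apply: leq_colex.
rewrite (bigD1 i) //= [X in _ <= X](bigD1 ord0) //= leq_add //.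
  by rewrite colexC leq_colex 1?eq_sym.
rewrite (bigD1 ord0) 1?eq_sym //= add0n.
rewrite (eq_bigl (fun j => (i != j) && (j != ord0))) => [|j]; last by rewrite eq_sym.
by apply: leq_sum => j /andP[ij _]; apply: leq_colex.
Qed.

(** * The labeling of the barbell with cliques on [n.+1] vertices *)

Section Barbell.

Variables (n : nat) (a b : 'I_n.+1).
Hypothesis n_ge2 : 2 <= n.

Let m := 'C(n.+1, 2).

(** The transpositions renumber each clique so that its end of the bridge becomes [ord_max]. *)
Definition barbell_label (u v : 'I_n.+1 + 'I_n.+1) : nat :=
  match u, v with
  | inl i, inl j => colex (tperm a ord_max i) (tperm a ord_max j)
  | inr i, inr j => m.+1 + colex (tperm b ord_max i) (tperm b ord_max j)
  | _, _ => m.+1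
  end.

Lemma barbell_labelC u v : barbell_label u v = barbell_label v u.
Proof. by case: u v => [i|i] [j|j] //=; rewrite colexC. Qed.

Lemma tperm_neq (c i j : 'I_n.+1) :
  i != j -> tperm c ord_max i != tperm c ord_max j :> nat.
Proof. by rewrite val_eqE (inj_eq perm_inj). Qed.

Lemma colex_tperm_bounds (c i j : 'I_n.+1) : i != j ->
  1 <= colex (tperm c ord_max i) (tperm c ord_max j) <= m.
Proof. by move=> /(tperm_neq c) ij; rewrite colex_gt0 colex_le. Qed.

Lemma colex_tperm_inj (c i j k l : 'I_n.+1) : i != j -> k != l ->
  colex (tperm c ord_max i) (tperm c ord_max j) =
  colex (tperm c ord_max k) (tperm c ord_max l) ->
  (i = k /\ j = l) \/ (i = l /\ j = k).
Proof.
move=> /(tperm_neq c) ij /(tperm_neq c) kl /(colex_inj ij kl).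
by move=> [][/val_inj/perm_inj-> /val_inj/perm_inj->]; auto.
Qed.

Lemma colex_tperm_surj (c : 'I_n.+1) (k : nat) : 1 <= k <= m ->
  exists i j : 'I_n.+1,
    i != j /\ colex (tperm c ord_max i) (tperm c ord_max j) = k.
Proof.
move=> /colex_surj[i [j [ij jn <-]]].
exists (tperm c ord_max (Ordinal (ltn_trans ij jn))), (tperm c ord_max (Ordinal jn)).
by rewrite !tpermK (inj_eq perm_inj) -val_eqE /= neq_ltn ij.
Qed.

Lemma barbell_label_inj u v x y :
  barbell_adj a b u v -> barbell_adj a b x y ->
  barbell_label u v = barbell_label x y -> [set u; v] = [set x; y].
Proof.
case: u v x y => [i|i] [j|j] [k|k] [l|l] //= uv xy;
  (* The label ranges of the first clique, the bridge and the second clique are disjoint, so [lia]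
     refutes equal labels on edges of different kinds. *)
  try (have := colex_tperm_bounds a uv); try (have := colex_tperm_bounds b uv);
  try (have := colex_tperm_bounds a xy); try (have := colex_tperm_bounds b xy);
  try lia.
- by move=> _ _ _ _ /(colex_tperm_inj uv xy)[][-> ->] //; rewrite setUC.
- by case/andP: uv xy => /eqP-> /eqP-> /andP[/eqP-> /eqP->].
- by case/andP: uv xy => /eqP-> /eqP-> /andP[/eqP-> /eqP->]; rewrite setUC.
- by case/andP: uv xy => /eqP-> /eqP-> /andP[/eqP-> /eqP->]; rewrite setUC.
- by case/andP: uv xy => /eqP-> /eqP-> /andP[/eqP-> /eqP->].
- by move=> _ _ _ _ /addnI/(colex_tperm_inj uv xy)[][-> ->] //; rewrite setUC.
Qed.

Lemma barbell_edge_labeling :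
  @edge_labeling (barbell a b) (set2_fun barbell_label).
Proof.
apply: (@edge_labelingI _ _ (m + m).+1).
- move=> e /edgesP[x [y [+ ->]]]; rewrite set2_funE; last exact: barbell_labelC.
  by case: x y => [i|i] [j|j] //= xy;
    have := colex_tperm_bounds a; have := colex_tperm_bounds b;
    move=> /(_ i j) + /(_ i j); try (move=> /(_ xy) + /(_ xy)); lia.
- move=> e e' /edgesP[x [y [xy ->]]] /edgesP[u [v [uv ->]]].
  rewrite !set2_funE; try exact: barbell_labelC.
  exact: barbell_label_inj.
- move=> k kq; suff [x [y [xy <-]]] :
      exists x y, barbell_adj a b x y /\ barbell_label x y = k.
    exists [set x; y]; first by apply/edgesP; exists x, y.
    by rewrite set2_funE //; apply: barbell_labelC.
  have [km|mk|->] := ltngtP k m.+1.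
  + have [|i [j [ij <-]]] := @colex_tperm_surj a k; first lia.
    by exists (inl i), (inl j).
  + have [|i [j [ij kE]]] := @colex_tperm_surj b (k - m.+1); first lia.
    by exists (inr i), (inr j); split => //=; rewrite kE; lia.
  + by exists (inl a), (inr b); rewrite /= !eqxx.
Qed.

(** The argument is a vertex after renumbering, so the bridge label goes to [ord_max]. *)
Definition bridged_sum (i : 'I_n.+1) : nat :=
  colex_sum i + (i == ord_max) * m.+1.

Lemma bridged_sum_lt (i j : 'I_n.+1) : i < j -> bridged_sum i < bridged_sum j.
Proof.
move=> ij; have := @colex_sum_lt n.+1 i j n_ge2 ij; rewrite /bridged_sum.
have -> : (i == ord_max) = false by rewrite -val_eqE /=; have := ltn_ord j; lia.
by lia.
Qed.

Lemma bridged_sum_inj : injective bridged_sum.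
Proof.
move=> i j E; case: (ltngtP i j) => [/bridged_sum_lt|/bridged_sum_lt|/val_inj//];
  by rewrite E ltnn.
Qed.

Lemma bridged_sum_lt_shift (i j : 'I_n.+1) :
  bridged_sum i < bridged_sum j + m.+1 * n.
Proof.
have := colex_sum_le i; have := leq_colex_sum j; rewrite /bridged_sum -/m /=.
(* The tightest case is [m * n + m.+1 < m + m.+1 * n], which amounts to [1 < n]. *)
by case: (i == ord_max); case: (j == ord_max); nia.
Qed.

Lemma sum_colex_tperm (c i : 'I_n.+1) :
  \sum_(j | i != j) colex (tperm c ord_max i) (tperm c ord_max j) =
  colex_sum (tperm c ord_max i).
Proof.
rewrite /colex_sum [RHS](reindex_inj (@perm_inj _ (tperm c ord_max))) /=.
by apply: eq_bigl => j; rewrite (inj_eq perm_inj).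
Qed.

Lemma tperm_eq_max (c i : 'I_n.+1) : (tperm c ord_max i == ord_max) = (i == c).
Proof. by rewrite -[ord_max in _ == ord_max](tpermL c ord_max) (inj_eq perm_inj). Qed.

Lemma vertex_sum_inl (i : 'I_n.+1) :
  @vertex_sum (barbell a b) (set2_fun barbell_label) (inl i) =
  bridged_sum (tperm a ord_max i).
Proof.
rewrite vertex_sumE; under eq_bigr do rewrite (set2_funE _ _ barbell_labelC).
rewrite big_sumType /= sum_colex_tperm /bridged_sum tperm_eq_max; congr (_ + _).
by case: eqVneq => ?; rewrite ?big_pred0_eq ?big_pred1_eq ?mul1n.
Qed.

Lemma vertex_sum_inr (i : 'I_n.+1) :
  @vertex_sum (barbell a b) (set2_fun barbell_label) (inr i) =
  bridged_sum (tperm b ord_max i) + m.+1 * n.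
Proof.
rewrite vertex_sumE; under eq_bigr do rewrite (set2_funE _ _ barbell_labelC).
rewrite big_sumType /= big_split /= sum_colex_tperm /bridged_sum tperm_eq_max.
(* Each of the [n] clique edges at the vertex carries the offset [m.+1]. *)
have -> : \sum_(j | i != j) m.+1 = m.+1 * n.
  rewrite sum_nat_const mulnC; congr (_ * _).
  rewrite -[n in RHS]/(n.+1.-1) -[n.+1 in RHS]card_ord -(cardC1 i).
  by apply: eq_card => j; rewrite !inE eq_sym.
have -> : \sum_(j | (j == a) && (i == b)) m.+1 = (i == b) * m.+1.
  case: (i == b); last by rewrite big1 // => j; rewrite andbF.
  by under eq_bigl do rewrite andbT; rewrite big_pred1_eq mul1n.
lia.
Qed.

Lemma barbell_vertex_sum_inj :
  injective (@vertex_sum (barbell a b) (set2_fun barbell_label)).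
Proof.
move=> [i|i] [j|j]; rewrite ?vertex_sum_inl ?vertex_sum_inr.
- by move=> /bridged_sum_inj/perm_inj->.
- move=> E; have := bridged_sum_lt_shift (tperm a ord_max i) (tperm b ord_max j).
  by rewrite E ltnn.
- move=> E; have := bridged_sum_lt_shift (tperm a ord_max j) (tperm b ord_max i).
  by rewrite E ltnn.
- by move=> /addIn/bridged_sum_inj/perm_inj->.
Qed.

End Barbell.

Theorem theorem3p1 (n : nat) (hn : 3 <= n) (a b : 'I_n) :
  antimagic (barbell a b).
Proof.
case: n hn a b => // n hn a b; exists (set2_fun (barbell_label a b)).
split; first exact: barbell_edge_labeling.
exact: barbell_vertex_sum_inj.
Qed.
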